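(* Let $\widehat{\mathbf M}=(\hat{\mathbb{X}},\hat x_0,\hat{\mathbb{U}},\hat{\mathbf t},\hat h,\mathbb{Y})$ and $\mathbf M=(\mathbb{X},x_0,\mathbb{U},\mathbf t,h,\mathbb{Y})$ be gMDPs such that $\widehat{\mathbf M}\preceq^{\delta}_{\varepsilon}\mathbf M$, witnessed by a measurable relation $\mathcal{R}\subset\hat{\mathbb{X}}\times\mathbb{X}$, an interface function $\mathcal{I}$ and a sub-probability kernel $\boldsymbol v$. Then there exists a state mapping $\mathbf s$ that defines a valid control refinement (with respect to $\mathcal{I}$ and $\boldsymbol v$).
   Context: All state and input spaces are Polish spaces with Borel $\sigma$-algebras. A gMDP $\mathbf M=(\mathbb{X},x_0,\mathbb{U},\mathbf t,h,\mathbb{Y})$ consists of a state space $\mathbb{X}$, initial state $x_0\in\mathbb{X}$, input space $\mathbb{U}$, a probability kernel $\mathbf t(\cdot\mid x,u)$ on $\mathbb{X}$ for each $(x,u)\in\mathbb{X}\times\mathbb{U}$, an output space $\mathbb{Y}$ equipped with a metric $\mathbf d_{\mathbb{Y}}$, and a measurable output map $h:\mathbb{X}\to\mathbb{Y}$. An interface function is a Borel measurable stochastic kernel $\mathcal{I}(\cdot\mid\hat x,x,\hat u)$ on $\mathbb{U}$ indexed by $(\hat x,x,\hat u)\in\hat{\mathbb{X}}\times\mathbb{X}\times\hat{\mathbb{U}}$; we write $\mathbf t(\cdot\mid x,\mathcal{I}(\cdot\mid\hat x,x,\hat u)):=\int_{\mathbb{U}}\mathbf t(\cdot\mid x,u)\,\mathcal{I}(du\mid\hat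 x,x,\hat u)$. Given probability measures $\hat p$ on $\hat{\mathbb{X}}$, $p$ on $\mathbb{X}$, a relation $\mathcal{R}$ and $\delta\in[0,1]$, a sub-probability coupling of $\hat p$ and $p$ over $\mathcal{R}$ w.r.t. $\delta$ is a measure $v$ on $\hat{\mathbb{X}}\times\mathbb{X}$ with $1\ge v(\hat{\mathbb{X}}\times\mathbb{X})\ge 1-\delta$, $v(\hat{\mathbb{X}}\times\mathbb{X})=v(\mathcal{R})$, $v(A\times\mathbb{X})\le\hat p(A)$ and $v(\hat{\mathbb{X}}\times B)\le p(B)$ for all measurable $A\subset\hat{\mathbb{X}}$, $B\subset\mathbb{X}$. $\widehat{\mathbf M}\preceq^{\delta}_{\varepsilon}\mathbf M$ ($(\varepsilon,\delta)$-sub-simulation relation) means: there exist a measurable $\mathcal{R}\subset\hat{\mathbb{X}}\times\mathbb{X}$, an interface function $\mathcal{I}$ and a sub-probability kernel $\boldsymbol v(\cdot\mid\hat x,x,\hat u)$ on $\hat{\mathbb{X}}\times\mathbb{X}$ such that (a) $(\hat x_0,x_0)\in\mathcal{R}$; (b) for all $(\hat x,x)\in\mathcal{R}$ and $\hat u\in\hat{\mathbb{U}}$, $\boldsymbol v(\cdot\mid\hat x,x,\hat u)$ is a sub-probability coupling of $\hat{\mathbf t}(\cdot\mid\hat x,\hat u)$ and $\mathbf t(\cdot\mid x,\mathcal{I}(\cdot\mid\hat x,x,\hat u))$ over $\mathcal{R}$ w.r.t. $\delta$; (c) $\mathbf d_{\mathbb{Y}}(\hat h(\hat x),h(x))\le\varepsilon$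 for all $(\hat x,x)\in\mathcal{R}$. A state mapping is a kernel $\mathbf s(\cdot\mid\hat x,x,x^+,\hat u)$ assigning to each $(\hat x,x,x^+,\hat u)\in\hat{\mathbb{X}}\times\mathbb{X}\times\mathbb{X}\times\hat{\mathbb{U}}$ a probability measure on $\hat{\mathbb{X}}$. It defines a valid control refinement (w.r.t. $\mathcal{I}$, $\boldsymbol v$) if the composed measure $\mathbf t_\times(d\hat x^+\times dx^+\mid\hat x,x,\hat u):=\mathbf s(d\hat x^+\mid\hat x,x,x^+,\hat u)\,\mathbf t(dx^+\mid x,\mathcal{I}(\cdot\mid\hat x,x,\hat u))$ satisfies $\mathbf t_\times(A\mid\hat x,x,\hat u)\ge\boldsymbol v(A\mid\hat x,x,\hat u)$ for all measurable $A\subset\hat{\mathbb{X}}\times\mathbb{X}$, all $(\hat x,x)\in\mathcal{R}$ and all $\hat u\in\hat{\mathbb{U}}$. *)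

(* Defs.v *)
From HB Require Import structures.
From mathcomp Require Import all_boot all_order all_algebra.
From mathcomp Require Import all_classical all_reals all_analysis.
Set Implicit Arguments. Unset Strict Implicit. Unset Printing Implicit Defensive.
Import Order.TTheory GRing.Theory Num.Theory.
Local Open Scope classical_set_scope.
Local Open Scope ring_scope.

Definition is_metric {R : realType} {T : Type} (dist : T -> T -> R) : Prop :=
  [/\ forall x y, 0 <= dist x y,
      forall x y, dist x y = 0 <-> x = y,
      forall x y, dist x y = dist y x &
      forall x y z, dist x z <= dist x y + dist y z].

Definition metric_open {R : realType} {T : Type} (dist : T -> T -> R)
  (A : set T) : Prop :=
  forall x, A x -> exists2 r : R, 0 < r & [set y | dist x y < r] `<=` A.

Definition metric_separable {R : realType} {T : Type} (dist : T -> T -> R) :=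
  exists2 D : set T, countable D &
    forall x (e : R), 0 < e -> exists2 y, D y & dist x y < e.

Definition metric_complete {R : realType} {T : Type} (dist : T -> T -> R) :=
  forall u : nat -> T,
    (forall e : R, 0 < e -> exists N, forall m n, (N <= m)%N -> (N <= n)%N ->
        dist (u m) (u n) < e) ->
    exists l, forall e : R, 0 < e -> exists N, forall n, (N <= n)%N ->
        dist (u n) l < e.

Definition polish_borel (R : realType) {d} (T : measurableType d) : Prop :=
  exists dist : T -> T -> R,
    [/\ is_metric dist, metric_separable dist, metric_complete dist &
        (@measurable d T) = <<s metric_open dist >>].

Definition kmix {R : realType} {dX dU dXh dUh}
  {X : measurableType dX} {U : measurableType dU}
  {Xh : measurableType dXh} {Uh : measurableType dUh}
  (t : R.-pker (X * U)%type ~> X) (I : R.-pker (Xh * X * Uh)%type ~> U)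
  (xh : Xh) (x : X) (uh : Uh) (B : set X) : \bar R :=
  (\int[I (xh, x, uh)]_u t (x, u) B)%E.

Definition sub_coupling {R : realType} {dXh dX}
  {Xh : measurableType dXh} {X : measurableType dX}
  (ph : set Xh -> \bar R) (p : set X -> \bar R) (Rel : set (Xh * X)%type)
  (delta : R) (v : set (Xh * X)%type -> \bar R) : Prop :=
  [/\ (v setT <= 1)%E, ((1 - delta)%:E <= v setT)%E, v setT = v Rel,
      forall A : set Xh, measurable A -> (v (A `*` setT) <= ph A)%E &
      forall B : set X, measurable B -> (v (setT `*` B) <= p B)%E].

Definition sub_sim_witness {R : realType} {dXh dUh dX dU dY}
  {Xh : measurableType dXh} {Uh : measurableType dUh}
  {X : measurableType dX} {U : measurableType dU} {Y : measurableType dY}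
  (dY_ : Y -> Y -> R)
  (xh0 : Xh) (th : R.-pker (Xh * Uh)%type ~> Xh) (hh : Xh -> Y)
  (x0 : X) (t : R.-pker (X * U)%type ~> X) (h : X -> Y)
  (eps delta : R)
  (Rel : set (Xh * X)%type) (I : R.-pker (Xh * X * Uh)%type ~> U)
  (v : R.-spker (Xh * X * Uh)%type ~> (Xh * X)%type) : Prop :=
  [/\ measurable Rel,
      Rel (xh0, x0),
      (forall xh x uh, Rel (xh, x) ->
         sub_coupling (th (xh, uh)) (kmix t I xh x uh) Rel delta
                      (v (xh, x, uh))) &
      (forall xh x, Rel (xh, x) -> dY_ (hh xh) (h x) <= eps)].

Definition sub_sim {R : realType} {dXh dUh dX dU dY}
  {Xh : measurableType dXh} {Uh : measurableType dUh}
  {X : measurableType dX} {U : measurableType dU} {Y : measurableType dY}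
  (dY_ : Y -> Y -> R)
  (xh0 : Xh) (th : R.-pker (Xh * Uh)%type ~> Xh) (hh : Xh -> Y)
  (x0 : X) (t : R.-pker (X * U)%type ~> X) (h : X -> Y)
  (eps delta : R) : Prop :=
  exists Rel I v, sub_sim_witness dY_ xh0 th hh x0 t h eps delta Rel I v.

(** composed measure
    [t_x(A | xh, x, uh) = \int s(sect_A(x+) | xh, x, x+, uh) t(dx+ | x, I(.|xh,x,uh))],
    where the mixture [t(dx+ | x, I(.|xh,x,uh)) = \int I(du|xh,x,uh) t(dx+|x,u)]
    is integrated iteratively. *)
Definition tcomposed {R : realType} {dX dU dXh dUh}
  {X : measurableType dX} {U : measurableType dU}
  {Xh : measurableType dXh} {Uh : measurableType dUh}
  (t : R.-pker (X * U)%type ~> X) (I : R.-pker (Xh * X * Uh)%type ~> U)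
  (s : R.-pker (Xh * X * X * Uh)%type ~> Xh)
  (xh : Xh) (x : X) (uh : Uh) (A : set (Xh * X)%type) : \bar R :=
  (\int[I (xh, x, uh)]_u
     \int[t (x, u)]_xp s (xh, x, xp, uh) [set xh' | A (xh', xp)])%E.

Definition valid_refinement {R : realType} {dX dU dXh dUh}
  {X : measurableType dX} {U : measurableType dU}
  {Xh : measurableType dXh} {Uh : measurableType dUh}
  (t : R.-pker (X * U)%type ~> X) (Rel : set (Xh * X)%type)
  (I : R.-pker (Xh * X * Uh)%type ~> U)
  (v : R.-spker (Xh * X * Uh)%type ~> (Xh * X)%type)
  (s : R.-pker (Xh * X * X * Uh)%type ~> Xh) : Prop :=
  forall xh x uh, Rel (xh, x) ->
    forall A : set (Xh * X)%type, measurable A ->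
      (v (xh, x, uh) A <= tcomposed t I s xh x uh A)%E.

(* Main.v *)
(** The refinement must disintegrate the coupling [v] along the new state [x+],
    measurably in the parameters [z = (xh, x, uh)].

    A Polish space is a measurable retract of the Cantor space, so that both
    state spaces may be described by sequences of bits. Write [p] for the law of
    [x+] under the interface. For every finite word [r], the measure
    [v (z, {bits of xh+ start with r} x .)] is dominated by [p z]; its density is
    a limit of the ratios of the two measures on the dyadic cells of [x+]. These
    ratios form a martingale bounded in L2, and along a subsequence chosen
    measurably in [z] they converge fast enough to bound the limsup, which gives
    a jointly measurable density.

    For almost every [x+] these densities are additive in [r], so they are the
    lengths of nested intervals: a uniform random number then selects a random bit
    sequence, which is decoded to [xh+]. The mass missing from the intervals is
    sent to an arbitrary point, hence an inequality rather than an equality. *)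

Require Import Defs.
From HB Require Import structures.
From mathcomp Require Import all_boot all_order all_algebra.
From mathcomp Require Import all_classical all_reals all_analysis.
From mathcomp Require Import measurable_realfun ring lra.
Import Order.TTheory GRing.Theory Num.Theory.
Local Open Scope classical_set_scope.
Local Open Scope ring_scope.

(** * Measurability over countable index types *)

Lemma countable_bigcup_measurable {d} {T : measurableType d} {I : countType}
  (P : set I) (F : I -> set T) :
  (forall i, P i -> measurable (F i)) -> measurable (\bigcup_(i in P) F i).
Proof.
move=> mF; rewrite bigcup_mkcond.
apply: countable_bigcupT_measurable => [|i]; first exact: countableP.
by case: ifPn => // /set_mem; exact: mF.
Qed.

Lemma countable_bigcap_measurable {d} {T : measurableType d} {I : countType}
  (P : set I) (F : I -> set T) :
  (forall i, P i -> measurable (F i)) -> measurable (\bigcap_(i in P) F i).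
Proof.
move=> mF; rewrite -[X in measurable X]setCK setC_bigcap.
apply: measurableC; apply: countable_bigcup_measurable => i Pi.
exact/measurableC/mF.
Qed.

(** Splitting by the value of [i] turns each preimage into a countable union. This serves to
    evaluate a family at a measurably chosen index. *)
Lemma measurable_fun_countable_family {d d' : measure_display}
  {Y : measurableType d} {T : measurableType d'} {I : countType}
  (i : Y -> I) (f : I -> Y -> T) :
  (forall j, measurable [set y | i y = j]) ->
  (forall j, measurable_fun setT (f j)) ->
  measurable_fun setT (fun y => f (i y) y).
Proof.
move=> mi mf _ B mB; rewrite setTI.
rewrite (_ : _ @^-1` B = \bigcup_j ([set y | i y = j] `&` f j @^-1` B)).
  apply: countable_bigcup_measurable => j _; apply: measurableI => //.
  by rewrite -[X in measurable X]setTI; exact: mf.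
by apply/seteqP; split => [y /= By|y [j _ [/= <-]]//]; exists (i y).
Qed.

(** * Cantor space *)

(** Binary words are stored newest letter first, so that extending a prefix by
    one letter is a [cons]. *)
Fixpoint rprefix (b : nat -> bool) (n : nat) : seq bool :=
  if n is m.+1 then b m :: rprefix b m else [::].

Lemma size_rprefix b n : size (rprefix b n) = n.
Proof. by elim: n => //= n ->. Qed.

Lemma drop_rprefix b n k : drop k (rprefix b (k + n)) = rprefix b n.
Proof. by elim: k => [|k IH]; rewrite ?drop0 ?addSn. Qed.

Definition cylinder (r : seq bool) : set (nat -> bool) :=
  [set b | rprefix b (size r) = r].

(** Two cylinders are nested or disjoint, so adding [set0] makes the family closed under
    intersection. *)
Definition cylinders : set (set (nat -> bool)) :=
  [set C | C = set0 \/ exists r, C = cylinder r].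

Lemma cylinder_nil : cylinder [::] = setT.
Proof. by apply/seteqP. Qed.

Lemma cylinder_cons c r :
  cylinder (c :: r) = cylinder r `&` [set b | b (size r) = c].
Proof.
apply/seteqP; split => b /=; rewrite /cylinder /=; first by case.
by move=> [-> ->].
Qed.

Lemma cylinderE r : cylinder r =
  cylinder (true :: r) `|` cylinder (false :: r).
Proof.
rewrite !cylinder_cons -setIUr; apply/esym/setIidPl => b _ /=.
by case: (b _); [left|right].
Qed.

Lemma cylinder_disj r :
  [disjoint cylinder (true :: r) & cylinder (false :: r)].
Proof.
rewrite !cylinder_cons disj_set2E; apply/eqP/seteqP; split => // b /=.
by move=> [[_ ->] []].
Qed.

Lemma setI_closed_cylinders : setI_closed cylinders.
Proof.
have sub r r' : (size r' <= size r)%N -> cylinders (cylinder r `&` cylinder r').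
  move=> le.
  (* The newest letter comes first, so the shorter prefix arises by dropping the head of the longer
     one. *)
  have pre b :
      drop (size r - size r') (rprefix b (size r)) = rprefix b (size r').
    by rewrite -{2}(subnK le) drop_rprefix.
  have [e|ne] := eqVneq (drop (size r - size r') r) r'.
    right; exists r; apply/setIidPl => b br; rewrite /cylinder /=.
    by rewrite -pre br.
  left; apply/seteqP; split => // b [br br']; move/eqP: ne; apply.
  by rewrite -[in LHS]br -[RHS]br' size_rprefix pre.
move=> A B [->|[r ->]]; first by left; rewrite set0I.
move=> [->|[r' ->]]; first by left; rewrite setI0.
have [le|/ltnW le] := leqP (size r') (size r); first exact: sub.
by rewrite setIC; exact: sub.
Qed.

Definition cantor := g_sigma_algebraType cylinders.

Lemma measurable_cylinder r : measurable (cylinder r : set cantor).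
Proof. by apply: sub_sigma_algebra; right; exists r. Qed.

Lemma measurable_bit n : measurable [set b : cantor | b n].
Proof.
rewrite (_ : [set b : cantor | b n] =
    \bigcup_(r in [set r | size r = n]) cylinder (true :: r)).
  by apply: countable_bigcup_measurable => r _; exact: measurable_cylinder.
apply/seteqP; split => [b /= bn|b [r /= <-]]; last first.
  by rewrite cylinder_cons => -[].
exists (rprefix b n); first exact: size_rprefix.
by rewrite cylinder_cons /cylinder /= size_rprefix.
Qed.

Lemma measurable_fun_cylinder {d} {T : measurableType d} (f : T -> cantor) :
  (forall r, measurable (f @^-1` cylinder r)) -> measurable_fun setT f.
Proof.
move=> mf; apply: (@measurability _ _ _ cantor setT f cylinders) => //.
move=> _ [B [->|[r ->]] <-].
  by rewrite preimage_set0 setI0.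
by rewrite setTI.
Qed.

Lemma measurable_fun_bits {d} {T : measurableType d} (f : T -> cantor) :
  (forall n, measurable [set x | f x n]) -> measurable_fun setT f.
Proof.
move=> mf; apply: measurable_fun_cylinder; elim => [|c r IH].
  by rewrite cylinder_nil preimage_setT.
rewrite cylinder_cons preimage_setI; apply: measurableI => //.
case: c; first exact: mf.
rewrite (_ : _ @^-1` _ = ~` [set x | f x (size r)]).
  exact/measurableC/mf.
by apply/seteqP; split => x /=; [move=> ->|move/negP/negbTE].
Qed.

(** A measurable retraction: [g] decodes every bit sequence, including those outside the range of
    [b]. *)
Definition cantor_code {d} {T : measurableType d}
  (b : T -> cantor) (g : cantor -> T) :=
  [/\ measurable_fun setT b, measurable_fun setT g & cancel b g].

Lemma measure_unique_cantor {R : realType}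
  (m1 m2 : {measure set cantor -> \bar R}) :
  (m1 setT < +oo)%E ->
  (forall r, m1 (cylinder r) = m2 (cylinder r)) ->
  forall A, measurable A -> m1 A = m2 A.
Proof.
move=> m1oo m12 A mA.
apply: (@measure_unique _ R cantor cylinders (fun=> setT)) => //.
- exact: setI_closed_cylinders.
- by move=> _; right; exists [::]; rewrite cylinder_nil.
- by rewrite bigcup_const.
- by move=> _ [->|[r ->]]; [rewrite !measure0|exact: m12].
Qed.

(** Since [g] undoes [b], every measurable [A] is the preimage under [b] of a measurable set of bit
    sequences, so it suffices to compare the push-forwards along [b]. *)
Lemma measure_unique_code {R : realType} {d} {T : measurableType d}
  (b : T -> cantor) (g : cantor -> T) (m1 m2 : {measure set T -> \bar R}) :
  cantor_code b g -> (m1 setT < +oo)%E ->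
  (forall r, m1 (b @^-1` cylinder r) = m2 (b @^-1` cylinder r)) ->
  forall A, measurable A -> m1 A = m2 A.
Proof.
move=> [mb mg bK] m1oo m12 A mA.
rewrite (_ : A = b @^-1` (g @^-1` A)); last first.
  by apply/seteqP; split => x /=; rewrite bK.
apply: (measure_unique_cantor (pushforward m1 b) (pushforward m2 b)) => //.
by rewrite -[X in measurable X]setTI; exact: mg.
Qed.

(** Downward induction on the word length: each value is the sum over the two one-letter extensions,
    so equality passes from length [n] to all shorter words. *)
Lemma additive_words_eq {R : realType} (F G : seq bool -> \bar R) n :
  (forall r, F r = (F (true :: r) + F (false :: r))%E) ->
  (forall r, G r = (G (true :: r) + G (false :: r))%E) ->
  (forall r, size r = n -> F r = G r) ->
  forall r, (size r <= n)%N -> F r = G r.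
Proof.
move=> Fadd Gadd FG r /subnK; move: (n - size r)%N => k.
elim: k r => [|k IH] r rn; first exact: FG.
by rewrite Fadd Gadd !IH// -rn addnS addSn.
Qed.

(** The least witness is a measurable choice: it equals [n] exactly when [P n] holds and all earlier
    conditions fail. *)
Lemma measurable_fun_first {d} {Y : measurableType d} (P : nat -> set Y) :
  (forall n, measurable (P n)) -> (forall y, exists n, P n y) ->
  exists N : Y -> nat,
    (forall y, P (N y) y) /\ (forall n, measurable [set y | N y = n]).
Proof.
move=> mP exP.
have exb y : exists n, `[< P n y >].
  by have [n ?] := exP y; exists n; apply/asboolP.
exists (fun y => ex_minn (exb y)); split => [y|n].
  by case: ex_minnP => m /asboolP.
rewrite (_ : [set _ | _] = P n `&` \bigcap_(i in [set i | (i < n)%N]) ~` P i).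
  apply: measurableI => //; apply: countable_bigcap_measurable => i _.
  exact: measurableC.
apply/seteqP; split => y /=.
  case: ex_minnP => m /asboolP Pm min <-; split => // i /= im /asboolP /min.
  by rewrite leqNgt im.
case: ex_minnP => m /asboolP Pm min [Pn Pi].
apply/eqP; rewrite eqn_leq min ?andbT; last exact/asboolP.
by rewrite leqNgt; apply/negP => /Pi.
Qed.

(** * Polish spaces as retracts of the Cantor space *)

Lemma exists_invr_lt {R : realType} (e : R) :
  0 < e -> exists k : nat, k.+1%:R^-1 < e.
Proof.
move=> e0; have [N _ /(_ _ (leqnn N)) ?] := near_infty_natSinv_lt (PosNum e0).
by exists N.
Qed.

(** The bits of [x] record which balls [B(q i, 1/(k+1))] contain [x], with [q] a
    dense sequence. A bit sequence is decoded to the unique point compatible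
    with the balls it names, provided these shrink and are pairwise close; this
    makes the decoder total and Borel without knowing that the range of the
    encoder is Borel. *)
Section polish_code.
Context {R : realType} {d : measure_display} {T : measurableType d}.
Variable dist : T -> T -> R.
Hypothesis dist_metric : is_metric dist.
Hypothesis dist_complete : metric_complete dist.
Hypothesis borel : (@measurable d T) = <<s metric_open dist >>.
Variable q : nat -> T.
Hypothesis q_dense : forall x (e : R), 0 < e -> exists i, dist x (q i) < e.

Let distC x y : dist x y = dist y x. Proof. by case: dist_metric. Qed.
Let distD x y z : dist x z <= dist x y + dist y z.
Proof. by case: dist_metric. Qed.

Let rad (k : nat) : R := k.+1%:R^-1.

Let rad_gt0 k : 0 < rad k. Proof. by rewrite invr_gt0. Qed.

Let rad_small (e : R) : 0 < e ->
  exists N, forall k, (N <= k)%N -> rad k < e.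
Proof.
move=> /exists_invr_lt[N Ne]; exists N => k Nk; apply: le_lt_trans Ne.
by rewrite lef_pV2 ?posrE// ler_nat.
Qed.

Let bit (k i : nat) : nat := choice.pickle (k, i).

Definition encode (x : T) : cantor := fun n =>
  if (choice.unpickle n : option (nat * nat)) is Some (k, i)
  then dist x (q i) < rad k else false.

Let encode_bit x k i : encode x (bit k i) = (dist x (q i) < rad k).
Proof. by rewrite /encode /bit choice.pickleK. Qed.

Let compatible (w : cantor) (x : T) : Prop :=
  forall k i, w (bit k i) -> dist x (q i) <= rad k.

Let good : set cantor :=
  (\bigcap_k \bigcup_i [set w : cantor | w (bit k i)]) `&`
  \bigcap_k \bigcap_i \bigcap_l \bigcap_(j in [set j |
      ~ dist (q i) (q j) <= rad k + rad l])
     ~` ([set w : cantor | w (bit k i)] `&` [set w : cantor | w (bit l j)]).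

Definition decode (w : cantor) : T :=
  if w \in good then xget point (compatible w) else point.

Let goodP w : good w <-> (forall k, exists i, w (bit k i)) /\
  (forall k i l j, w (bit k i) -> w (bit l j) ->
    dist (q i) (q j) <= rad k + rad l).
Proof.
split=> [[w1 w2]|[w1 w2]]; split.
- by move=> k; have [i _ ?] := w1 k I; exists i.
- move=> k i l j wki wlj; apply: contrapT => far.
  by have := w2 k I i I l I j far; apply.
- by move=> k _; have [i ?] := w1 k; exists i.
- by move=> k _ i _ l _ j far [wki wlj]; apply: far; exact: w2.
Qed.

Let measurable_good : measurable good.
Proof.
apply: measurableI.
  apply: countable_bigcap_measurable => k _.
  by apply: countable_bigcup_measurable => i _; exact: measurable_bit.
do 4 (apply: countable_bigcap_measurable => ? _).
by apply: measurableC; apply: measurableI; exact: measurable_bit.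
Qed.

Let compatible_unique w x y : good w -> compatible w x -> compatible w y ->
  x = y.
Proof.
move=> /goodP[w1 _] wx wy; have [d0 d1 _ _] := dist_metric; apply/d1.
apply/eqP; rewrite eq_le d0 andbT; apply/ler_addgt0Pl => e e0; rewrite addr0.
have [|N /(_ _ (leqnn N)) rN] := rad_small (e / 2); first exact: divr_gt0.
have [i wi] := w1 N.
rewrite (le_trans (distD x (q i) y))// (splitr e) lerD//.
  by rewrite (le_trans (wx _ _ wi))// ltW.
by rewrite distC (le_trans (wy _ _ wi))// ltW.
Qed.

Let compatible_ex w : good w -> exists x, compatible w x.
Proof.
move=> /goodP[w1 w2]; have [i wi] := choice w1.
(* One named ball is picked for each radius; by the pairwise closeness in [good] the centres form a
   Cauchy sequence. *)
have [|x qx] := dist_complete (q \o i).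
  move=> e e0.
  have [|N rN] := rad_small (e / 2); first exact: divr_gt0.
  exists N => m n Nm Nn /=; apply: le_lt_trans (w2 _ _ _ _ (wi m) (wi n)) _.
  by rewrite (splitr e) ltrD// rN.
exists x => k j wkj; apply/ler_addgt0Pl => e e0.
have [|N rN] := rad_small (e / 2); first exact: divr_gt0.
have [|M qM] := qx (e / 2); first exact: divr_gt0.
pose n := maxn N M.
rewrite (le_trans (distD x (q (i n)) (q j)))//.
have h1 : dist x (q (i n)) < e / 2 by rewrite distC qM// leq_maxr.
have h2 : dist (q (i n)) (q j) <= rad n + rad k := w2 _ _ _ _ (wi n) wkj.
have h3 : rad n < e / 2 by rewrite rN// leq_maxl.
by move: h1 h2 h3 => /=; lra.
Qed.

Let decodeP w : good w -> compatible w (decode w).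
Proof.
move=> gw; rewrite /decode mem_set//; apply: xgetPex.
exact: compatible_ex.
Qed.

Lemma encodeK : cancel encode decode.
Proof.
move=> x.
have gx : good (encode x).
  apply/goodP; split => [k|k i l j].
    by have [i ?] := q_dense x (rad k) (rad_gt0 k); exists i; rewrite encode_bit.
  rewrite !encode_bit => xi xj; rewrite (le_trans (distD _ x _))//.
  by rewrite distC lerD// ltW.
apply: compatible_unique (decodeP _ gx) _ => // k i.
by rewrite encode_bit => /ltW.
Qed.

Lemma measurable_encode : measurable_fun setT encode.
Proof.
apply: measurable_fun_bits => n; rewrite /encode.
case: (choice.unpickle n) => [[k i]|]; last first.
  by rewrite (_ : [set _ | _] = set0)//; apply/seteqP; split.
rewrite borel; apply: sub_sigma_algebra => x /= xk.
exists (rad k - dist x (q i)); first by rewrite subr_gt0.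
move=> y /= xy; rewrite (le_lt_trans (distD y x (q i)))//.
by rewrite -ltrBrDr distC.
Qed.

(** A good sequence decodes into an open [V] exactly when it names a ball whose closed version lies
    in [V], a countable union of conditions on bits. Off [good] the decoder is constant. *)
Lemma measurable_decode : measurable_fun setT decode.
Proof.
apply: (@measurability _ _ _ _ _ _ (metric_open dist)) => // _ [V oV <-].
rewrite setTI.
rewrite (_ : _ @^-1` _ = (good `&` \bigcup_k \bigcup_(i in [set i |
      [set x | dist x (q i) <= rad k] `<=` V]) [set w : cantor | w (bit k i)])
    `|` (~` good `&` [set _ | V point])).
  apply: measurableU; apply: measurableI => //.
  - apply: countable_bigcup_measurable => k _.
    by apply: countable_bigcup_measurable => i _; exact: measurable_bit.
  - exact: measurableC.
  - have [Vp|Vp] := pselect (V point).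
      by rewrite (_ : [set _ | _] = setT)//; apply/seteqP; split.
    by rewrite (_ : [set _ | _] = set0)//; apply/seteqP; split.
apply/seteqP; split => w /=.
  have [gw|gw] := pselect (good w); last first.
    by rewrite /decode memNset// => Vp; right.
  move=> Vw; left; split => //.
  have [r r0 rV] := oV _ Vw.
  (* A closed ball of radius below [r / 2] that contains the decoded point stays within distance [r]
     of it. *)
  have [|N /(_ _ (leqnn N)) rN] := rad_small (r / 2); first exact: divr_gt0.
  have [/(_ N)[i wi] _] := (goodP w).1 gw.
  exists N => //; exists i => //= y /= yi; apply: rV => /=.
  rewrite (le_lt_trans (distD _ (q i) _))// (splitr r).
  rewrite ler_ltD//; first by rewrite (le_trans (decodeP _ gw _ _ wi))// ltW.
  by rewrite distC (le_lt_trans yi).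
move=> [[gw [k _ [i iV wi]]]|[gw Vp]].
  by apply: iV => /=; exact: decodeP.
by rewrite /decode memNset.
Qed.

End polish_code.

Lemma polish_cantor_code {R : realType} {d : measure_display}
  {T : measurableType d} : polish_borel R T ->
  exists (b : T -> cantor) (g : cantor -> T), cantor_code b g.
Proof.
move=> [dist [dist_metric [D cD D_dense] dist_complete borel]].
have /pcard_surjP[q qD] : (D #<= [set: nat])%card by [].
have q_dense x e : 0 < e -> exists i, dist x (q i) < e.
  by move=> /(D_dense x)[y /qD[i _ <-]]; exists i.
exists (encode dist q), (decode dist q); split.
- exact: measurable_encode.
- exact: measurable_decode.
- exact: encodeK.
Qed.

(** * Jointly measurable densities *)

Lemma limn_esup_ub {R : realType} (u : nat -> \bar R) l n0 :
  (forall n, (n0 <= n)%N -> (u n <= l)%E) -> (limn_esup u <= l)%E.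
Proof.
move=> ul; rewrite limn_esup_lim; apply: lime_le; first exact: is_cvg_esups.
exists n0 => // n /= n0n; apply: ge_ereal_sup => _ [m /= nm <-].
exact/ul/(leq_trans n0n).
Qed.

Lemma limn_esup_lb {R : realType} (u : nat -> \bar R) l n0 :
  (forall n, (n0 <= n)%N -> (l <= u n)%E) -> (l <= limn_esup u)%E.
Proof.
move=> lu; rewrite limn_esup_lim; apply: lime_ge; first exact: is_cvg_esups.
exists n0 => // n /= n0n; apply: le_trans (lu n n0n) _.
by apply: ereal_sup_ubound; exists n => /=.
Qed.

(** * Measures given by a density *)

Section measure_of_density.
Local Open Scope ereal_scope.
Context {R : realType} {d : measure_display} {T : measurableType d}.
Variables (m : {measure set T -> \bar R}) (f : T -> \bar R).
Hypotheses (mf : measurable_fun setT f) (f0 : forall x, 0 <= f x).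

Definition density_measure (A : set T) : \bar R := \int[m]_(x in A) f x.

Let density_measure0 : density_measure set0 = 0.
Proof. exact: integral_set0. Qed.

Let density_measure_ge0 A : 0 <= density_measure A.
Proof. exact: integral_ge0. Qed.

Let density_measure_semi_sigma_additive : semi_sigma_additive density_measure.
Proof.
move=> F mF tF mUF; rewrite /density_measure ge0_integral_bigcup//.
  by apply: is_cvg_ereal_nneg_natsum => n _; exact: integral_ge0.
exact: measurable_funTS.
Qed.

HB.instance Definition _ := isMeasure.Build _ _ _ density_measure
  density_measure0 density_measure_ge0 density_measure_semi_sigma_additive.

End measure_of_density.

(** * Ratios on dyadic cells and their martingale identities *)

Section kernel_density.
Context {R : realType} {dZ dX : measure_display}.
Context {Z : measurableType dZ} {X : measurableType dX}.
Variables (b : X -> cantor) (g : cantor -> X).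
Hypothesis bg : cantor_code b g.
Variables (mu : R.-pker Z ~> X) (nu : Z -> {measure set X -> \bar R}).
Hypothesis mnu : forall B, measurable B -> measurable_fun setT (fun z => nu z B).

Let cell r : set X := b @^-1` cylinder r.

Let measurable_cell r : measurable (cell r).
Proof.
have [mb _ _] := bg; rewrite -[X in measurable X]setTI; apply: mb => //.
exact: measurable_cylinder.
Qed.

Let cell_split r : cell r = cell (true :: r) `|` cell (false :: r).
Proof. by rewrite /cell [in LHS]cylinderE preimage_setU. Qed.

Let cell_disj r : [disjoint cell (true :: r) & cell (false :: r)].
Proof.
rewrite disj_set2E; apply/eqP/seteqP; split => // x [xt xf].
have /eqP := cylinder_disj r; rewrite -subset0; apply; split.
- exact: xt.
- exact: xf.
Qed.

Let measurable_rprefix n r : measurable [set x | rprefix (b x) n = r].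
Proof.
have [<-|nr] := eqVneq (size r) n; first exact: measurable_cell.
rewrite (_ : [set _ | _] = set0)//; apply/seteqP; split => // x /= xr.
by move: nr; rewrite -xr size_rprefix eqxx.
Qed.

(* Division by zero gives 0, as it should when [mu z] vanishes on the cell and
   dominates [nu z]; the cap only matters when [mu z] does not dominate [nu z]. *)
Let ratio r (z : Z) : R :=
  Num.min 1 (fine (nu z (cell r)) / fine (mu z (cell r))).

Let ratio_ge0 r z : 0 <= ratio r z.
Proof. by rewrite le_min ler01 divr_ge0// fine_ge0. Qed.

Let ratio_le1 r z : ratio r z <= 1.
Proof. by rewrite ge_min lexx. Qed.

Let measurable_ratio r : measurable_fun setT (ratio r).
Proof.
apply: measurable_minr => //.
rewrite (_ : (fun z => _) = (fun z => fine (nu z (cell r)) *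
    (fine (mu z (cell r)) `^ (-1))))%R; last first.
  by apply/funext => z; rewrite powR_inv1// fine_ge0.
apply: measurable_funM; first by apply: measurableT_comp => //; exact: mnu.
apply: (measurableT_comp (measurable_powR _)).
by apply: measurableT_comp => //; exact: measurable_kernel.
Qed.

(** The martingale at level [n]: a function of [x] that is constant on each cell of level [n]. *)
Let dens n (zx : Z * X) : R := ratio (rprefix (b zx.2) n) zx.1.

Let dens_ge0 n zx : 0 <= dens n zx. Proof. exact: ratio_ge0. Qed.

Let dens_le1 n zx : dens n zx <= 1. Proof. exact: ratio_le1. Qed.

Let measurable_dens n : measurable_fun setT (dens n).
Proof.
apply: (measurable_fun_countable_family
  (fun zx : Z * X => rprefix (b zx.2) n) (fun r zx => ratio r zx.1)) => r.
  rewrite (_ : [set _ | _] = setT `*` [set x | rprefix (b x) n = r]).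
    exact: measurableX.
  by apply/seteqP; split => [[z x] /= ?|[z x] /= []//].
exact: measurableT_comp.
Qed.

(** Domination is a condition on a single parameter: the coupling bounds hold only on the relation,
    while the density must be defined and measurable for all [z]. *)
Let dominated z := forall B, measurable B -> (nu z B <= mu z B)%E.

Let mu_fin z B : measurable B -> mu z B \is a fin_num.
Proof. exact: finite_kernel_measure. Qed.

Let nu_fin z B : dominated z -> measurable B -> nu z B \is a fin_num.
Proof.
move=> dz mB; rewrite ge0_fin_numE//; apply: le_lt_trans (dz _ mB) _.
by rewrite -ge0_fin_numE//; exact: mu_fin.
Qed.

Let ratioE z r : dominated z ->
  ((ratio r z)%:E * mu z (cell r) = nu z (cell r))%E.
Proof.
move=> dz; have mC := measurable_cell r.
have le := dz _ mC; have nf := nu_fin z _ dz mC; have mf := mu_fin z _ mC.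
rewrite -(fineK nf) -(fineK mf) lee_fin in le *; rewrite -EFinM; congr EFin.
have [m0|m0] := eqVneq (fine (mu z (cell r))) 0.
  rewrite m0 mulr0; apply/esym/eqP; rewrite eq_le fine_ge0// andbT.
  by rewrite -m0.
rewrite /ratio min_r ?divfK// ler_pdivrMr ?mul1r//.
by rewrite lt_def m0 fine_ge0.
Qed.

Let measurable_densx n z : measurable_fun setT (fun x => dens n (z, x)).
Proof. exact: measurableT_comp. Qed.

Let integral_split z (h : X -> \bar R) r : measurable_fun setT h ->
  (forall x, 0 <= h x)%E ->
  (\int[mu z]_(x in cell r) h x = \int[mu z]_(x in cell (true :: r)) h x
     + \int[mu z]_(x in cell (false :: r)) h x)%E.
Proof.
move=> mh h0; rewrite [in LHS]cell_split ge0_integral_setU//.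
exact: measurable_funTS.
Qed.

(** The martingale property: on cells of level [n] this is [ratioE], and coarser cells follow by
    additivity. *)
Let integral_dens n z r : dominated z -> (size r <= n)%N ->
  (\int[mu z]_(x in cell r) (dens n (z, x))%:E = nu z (cell r))%E.
Proof.
move=> dz; apply: (additive_words_eq
  (fun r => \int[mu z]_(x in cell r) (dens n (z, x))%:E)%E
  (fun r => nu z (cell r))) => {r} r.
- by apply: integral_split => [|x]; [exact/measurable_EFinP|rewrite lee_fin].
- rewrite [in LHS]cell_split measureU//.
  by apply/eqP; rewrite -disj_set2E; exact: cell_disj.
- move=> rn; rewrite -ratioE// -integral_cst//; apply: eq_integral => x.
  by rewrite inE /cell /dens /cylinder /= rn => ->.
Qed.

Let sqint z n : \bar R := (\int[mu z]_x ((dens n (z, x)) ^+ 2)%:E)%E.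

Let sqint_ge0 z n : (0 <= sqint z n)%E.
Proof. by apply: integral_ge0 => x _; rewrite lee_fin sqr_ge0. Qed.

Let sqint_le1 z n : (sqint z n <= 1)%E.
Proof.
rewrite -[leRHS](@prob_kernel _ _ _ _ _ mu z) -[leRHS]mul1e -integral_cst//.
apply: ge0_le_integral => //.
- by move=> x _; rewrite lee_fin sqr_ge0.
- by apply/measurable_EFinP; exact: measurable_funX.
- by move=> x _; rewrite lee_fin expr_le1.
Qed.

Let sqint_fin z n : sqint z n \is a fin_num.
Proof. by rewrite ge0_fin_numE// (le_lt_trans (sqint_le1 _ _))// ltry. Qed.

Let measurable_sqint n : measurable_fun setT (fun z => sqint z n).
Proof.
apply: (measurable_fun_integral_finite_kernel
    (fun zx => ((dens n zx) ^+ 2)%:E)) => [zx|].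
  by rewrite lee_fin sqr_ge0.
by apply/measurable_EFinP; exact: measurable_funX.
Qed.

(** On a cell of level [m] the factor [dens m] is constant and leaves the integral; what remains is
    the mass of the cell under [nu z], the same for [dens n] as for [dens m]. *)
Let integral_densM z m n : dominated z -> (m <= n)%N ->
  (\int[mu z]_x (dens m (z, x) * dens n (z, x))%:E = sqint z m)%E.
Proof.
move=> dz mn; rewrite /sqint -(preimage_setT b) -cylinder_nil.
apply: (additive_words_eq
  (fun r => \int[mu z]_(x in cell r) (dens m (z, x) * dens n (z, x))%:E)%E
  (fun r => \int[mu z]_(x in cell r) (dens m (z, x) ^+ 2)%:E)%E m) => // r.
- apply: integral_split => [|x].
    by apply/measurable_EFinP; exact: measurable_funM.
  by rewrite lee_fin mulr_ge0.
- apply: integral_split => [|x]; last by rewrite lee_fin sqr_ge0.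
  by apply/measurable_EFinP; exact: measurable_funX.
move=> rm.
transitivity ((ratio r z)%:E * \int[mu z]_(x in cell r) (dens n (z, x))%:E)%E.
  rewrite -ge0_integralZl_EFin//.
  - apply: eq_integral => x; rewrite inE /cell /dens /cylinder /= rm => ->.
    by rewrite EFinM.
  - by move=> x _; rewrite lee_fin.
  - by apply: measurable_funTS; exact/measurable_EFinP.
transitivity ((ratio r z)%:E * \int[mu z]_(x in cell r) (dens m (z, x))%:E)%E.
  by rewrite !integral_dens// rm.
rewrite -ge0_integralZl_EFin//.
- apply: eq_integral => x; rewrite inE /cell /dens /cylinder /= rm => ->.
  by rewrite expr2 EFinM.
- by move=> x _; rewrite lee_fin.
- by apply: measurable_funTS; exact/measurable_EFinP.
Qed.

(** Pythagoras: the increment from level [m] to level [n] is orthogonal to [dens m]. *)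
Let integral_sqdist z m n : dominated z -> (m <= n)%N ->
  (\int[mu z]_x ((dens m (z, x) - dens n (z, x)) ^+ 2)%:E + sqint z m
   = sqint z n)%E.
Proof.
move=> dz mn.
have m2 k : measurable_fun setT (fun x => ((dens k (z, x)) ^+ 2)%:E).
  by apply/measurable_EFinP; exact: measurable_funX.
have mM : measurable_fun setT (fun x => (dens m (z, x) * dens n (z, x))%:E).
  by apply/measurable_EFinP; exact: measurable_funM.
have mD : measurable_fun setT
    (fun x => ((dens m (z, x) - dens n (z, x)) ^+ 2)%:E).
  by apply/measurable_EFinP/measurable_funX; exact: measurable_funB.
have ge0M x : (0 <= (dens m (z, x) * dens n (z, x))%:E)%E.
  by rewrite lee_fin mulr_ge0.
have ge02 (y : R) : (0 <= (y ^+ 2)%:E)%E by rewrite lee_fin sqr_ge0.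
(* The cross terms are moved to the left, so that all integrands are nonnegative and integrals add
   without integrability conditions. *)
have : (\int[mu z]_x (((dens m (z, x) - dens n (z, x)) ^+ 2)%:E
     + ((dens m (z, x) * dens n (z, x))%:E + (dens m (z, x) * dens n (z, x))%:E))
   = \int[mu z]_x ((dens n (z, x) ^+ 2)%:E + (dens m (z, x) ^+ 2)%:E))%E.
  by apply: eq_integral => x _; rewrite -!EFinD; congr EFin; ring.
rewrite !ge0_integralD//; last 2 first.
- by move=> x _; rewrite adde_ge0.
- exact: emeasurable_funD.
rewrite !integral_densM// -/(sqint z n) -/(sqint z m) addeA.
move=> /(congr1 (fun y => y - sqint z m)%E).
by rewrite !addeK.
Qed.

(** Integrating the pointwise bound [|h| <= h^2 / (2e) + e / 2] against a probability measure gives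
    [e / 2 + e / 2]. *)
Let l1_le_l2 z (h : X -> R) (e : R) : measurable_fun setT h -> 0 < e ->
  (\int[mu z]_x ((h x) ^+ 2)%:E <= (e ^+ 2)%:E)%E ->
  (\int[mu z]_x `|h x|%:E <= e%:E)%E.
Proof.
move=> mh e0 h2.
have c0 : 0 <= (2 * e)^-1 by rewrite invr_ge0 mulr_ge0// ltW.
have m2 : measurable_fun setT (fun x => ((h x) ^+ 2)%:E).
  by apply/measurable_EFinP; exact: measurable_funX.
have ge02 x : (0 <= (h x ^+ 2)%:E)%E by rewrite lee_fin sqr_ge0.
have ge0e : (0 <= (e / 2)%:E)%E by rewrite lee_fin divr_ge0// ltW.
apply: (@le_trans _ _
    (\int[mu z]_x ((2 * e)^-1%:E * ((h x) ^+ 2)%:E + (e / 2)%:E))%E).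
  apply: ge0_le_integral => //.
  - by apply/measurable_EFinP; exact: measurableT_comp.
  - by apply: emeasurable_funD => //; exact: measurable_funeM.
  - move=> x _; rewrite -EFinM -EFinD lee_fin -subr_ge0.
    rewrite (_ : _ - _ = (2 * e)^-1 * (`|h x| - e) ^+ 2).
      by rewrite mulr_ge0// sqr_ge0.
    rewrite -[h x ^+ 2]real_normK ?num_real//; field.
    by rewrite lt0r_neq0.
rewrite ge0_integralD//; last 2 first.
- by move=> x _; rewrite mule_ge0// lee_fin.
- exact: measurable_funeM.
rewrite ge0_integralZl_EFin// integral_cst// prob_kernel mule1.
apply: (@le_trans _ _ ((2 * e)^-1%:E * (e ^+ 2)%:E + (e / 2)%:E)%E).
  by rewrite leeD2r// lee_wpmul2l// lee_fin.
rewrite -EFinM -EFinD lee_fin le_eqVlt; apply/orP; left; apply/eqP; field.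
by rewrite lt0r_neq0.
Qed.

Let sq z n := fine (sqint z n).

Let half (k : nat) : R := 2^-1 ^+ k.

Let half_gt0 k : 0 < half k. Proof. by rewrite exprn_gt0// invr_gt0. Qed.

(** The squared norm at [n] is within 4^-k of its supremum over indices from [k] on. Quantifying
    over [m] instead of naming the supremum exhibits a countable intersection, measurable in [z]. *)
Let near_sup k : set (nat * Z) := [set nz | (k <= nz.1)%N /\
  forall m, (k <= m)%N -> sq nz.2 m <= sq nz.2 nz.1 + half k ^+ 2].

Let exists_near_sup k z : exists n, near_sup k (n, z).
Proof.
pose E := [set sq z m | m in [set m | (k <= m)%N]].
have supE : has_sup E.
  split; first by exists (sq z k), k => /=.
  exists 1 => _ [m _ <-].
  by rewrite -lee_fin fineK ?sqint_le1.
have e0 : 0 < half k ^+ 2 by rewrite exprn_gt0.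
have [_ [n kn <-] supn] := sup_adherent e0 supE.
exists n; split => // m km.
rewrite -lerBlDr (le_trans _ (ltW supn))// lerB//.
by apply: ub_le_sup; [case: supE|exists m].
Qed.

Let measurable_near_sup k n : measurable [set z | near_sup k (n, z)].
Proof.
have [kn|kn] := leqP k n; last first.
  rewrite (_ : [set _ | _] = set0)//; apply/seteqP; split => // z [/= h _].
  by move: kn; rewrite ltnNge h.
rewrite (_ : [set _ | _] = \bigcap_(m in [set m | (k <= m)%N])
    [set z | sq z m <= sq z n + half k ^+ 2]); last first.
  by apply/seteqP; split => z /=; [case|split].
have msq i : measurable_fun setT (sq ^~ i) by exact: measurableT_comp.
apply: countable_bigcap_measurable => m _.
rewrite -[X in measurable X]setTI.
have := measurable_fun_ler (msq m)
  (measurable_funD (msq n) (measurable_cst (half k ^+ 2))).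
by move=> /(_ measurableT [set true]); apply.
Qed.

Let sq_nondecreasing z m n : dominated z -> (m <= n)%N -> sq z m <= sq z n.
Proof.
move=> dz mn; rewrite -lee_fin !fineK// -(integral_sqdist _ _ _ dz mn) leeDr//.
by apply: integral_ge0 => x _; rewrite lee_fin sqr_ge0.
Qed.

(** By Pythagoras the squared distance is the difference of two squared norms, both within the
    tolerance of the supremum. *)
Let sqdist_le z k m n : dominated z -> (k <= m)%N -> (k <= n)%N ->
  near_sup k (m, z) -> near_sup k (n, z) ->
  (\int[mu z]_x ((dens m (z, x) - dens n (z, x)) ^+ 2)%:E <=
    (half k ^+ 2)%:E)%E.
Proof.
move=> dz; wlog mn : m n / (m <= n)%N => [wl km kn Pm Pn|].
  have [mn|/ltnW nm] := leqP m n; first exact: wl.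
  by under eq_integral do rewrite -sqrrN opprB; exact: wl.
move=> km kn [_ /= Pm] _.
have := integral_sqdist _ _ _ dz mn; rewrite -(fineK (sqint_fin z m)).
rewrite -(fineK (sqint_fin z n)) => /(congr1 (fun y => y - (sq z m)%:E)%E).
rewrite addeK// => ->; rewrite -EFinB lee_fin lerBlDl.
exact: Pm.
Qed.

(** * The limit along a measurably chosen subsequence *)

Section limit.
Variable N : nat -> Z -> nat.
Hypothesis NP : forall k z, near_sup k (N k z, z).
Hypothesis mN : forall k n, measurable [set z | N k z = n].

Let u k (zx : Z * X) : R := dens (N k zx.1) zx.

Let measurable_u k : measurable_fun setT (u k).
Proof.
apply: (measurable_fun_countable_family
  (fun zx : Z * X => N k zx.1) (fun n zx => dens n zx)) => // n.
rewrite (_ : [set _ | _] = [set z | N k z = n] `*` setT).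
  exact: measurableX.
by apply/seteqP; split => [[z x] /= ?|[z x] /= []//].
Qed.

(** The limsup exists at every point, which gives joint measurability and values in [0, 1] even
    where the subsequence diverges. *)
Definition limit_density (zx : Z * X) : \bar R :=
  limn_esup (fun k => (u k zx)%:E).

Let F := limit_density.

Lemma measurable_limit_density : measurable_fun setT F.
Proof.
by apply: measurable_fun_limn_esup => k; exact/measurable_EFinP.
Qed.

Lemma limit_density_ge0 zx : (0 <= F zx)%E.
Proof. by apply: (limn_esup_lb _ _ 0%N) => n _; rewrite lee_fin dens_ge0. Qed.

Lemma limit_density_le1 zx : (F zx <= 1)%E.
Proof. by apply: (limn_esup_ub _ _ 0%N) => n _; rewrite lee_fin dens_le1. Qed.

(** The total variation of the sequence from index [k] on. It may be infinite at a point, yet it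
    bounds the distance from [u k] to the limsup and has a small integral. *)
Let tail k (zx : Z * X) : \bar R :=
  (\sum_(0 <= j <oo) `|u (k + j).+1 zx - u (k + j) zx|%:E)%E.

Let tail_ge0 k zx : (0 <= tail k zx)%E.
Proof. by apply: nneseries_ge0 => j _ _; rewrite lee_fin. Qed.

Let dist_tail k i zx : (`|u (k + i) zx - u k zx|%:E <= tail k zx)%E.
Proof.
apply: (@le_trans _ _
  (\sum_(0 <= j < i) `|u (k + j).+1 zx - u (k + j) zx|%:E)%E); last first.
  by apply: nneseries_lim_ge => j _ _; rewrite lee_fin.
rewrite sumEFin lee_fin; elim: i => [|i IH].
  by rewrite big_nil addn0 subrr normr0.
rewrite big_nat_recr//= addnS.
rewrite (_ : _ - _ = u (k + i)%N zx - u k zx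
  + (u (k + i).+1 zx - u (k + i)%N zx)); last by ring.
by rewrite (le_trans (ler_normD _ _))// lerD2r.
Qed.

Let le_tail k i zx : ((u (k + i) zx)%:E <= (u k zx)%:E + tail k zx)%E /\
  ((u k zx)%:E <= (u (k + i) zx)%:E + tail k zx)%E.
Proof.
split.
  apply: le_trans (leeD2l _ (dist_tail k i zx)).
  by rewrite -EFinD lee_fin -lerBlDl ler_norm.
apply: le_trans (leeD2l _ (dist_tail k i zx)).
by rewrite -EFinD lee_fin -lerBlDl distrC ler_norm.
Qed.

Let limit_density_le k zx : (F zx <= (u k zx)%:E + tail k zx)%E.
Proof.
apply: (limn_esup_ub _ _ k) => n kn; rewrite -(subnKC kn).
by have [] := le_tail k (n - k)%N zx.
Qed.

Let le_limit_density k zx : ((u k zx)%:E <= F zx + tail k zx)%E.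
Proof.
have h i := (le_tail k i zx).2.
(* If the tail is infinite, so is the right-hand side, because [F] is nonnegative and hence not
   -oo. *)
move: h (tail_ge0 k zx); case: (tail k zx) => [s| |//] h _; last first.
  rewrite addey ?leey//; apply/negP => /eqP Fy.
  by have := limit_density_ge0 zx; rewrite -/F Fy.
rewrite -leeBlDr//; apply: (limn_esup_lb _ _ k) => n kn.
by rewrite leeBlDr// -(subnKC kn).
Qed.

Let measurable_tail k z : measurable_fun setT (fun x => tail k (z, x)).
Proof.
apply: (measurableT_comp (f := tail k)) => //.
apply: ge0_emeasurable_sum => [j zx _ _|j _]; first by rewrite lee_fin.
apply/measurable_EFinP; apply: measurableT_comp => //.
exact: measurable_funB.
Qed.

(** Consecutive chosen indices are both near-optimal at level [k + j], so the increment has L1 norm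
    at most 2^-(k+j); the geometric series sums to 2 * 2^-k. *)
Let integral_tail k z : dominated z ->
  (\int[mu z]_x tail k (z, x) <= (2 * half k)%:E)%E.
Proof.
move=> dz; rewrite integral_nneseries//; last first.
  move=> j; apply/measurable_EFinP; apply: measurableT_comp => //.
  by apply: measurable_funB; exact: measurableT_comp.
apply: (@le_trans _ _ (\sum_(0 <= j <oo) (2 / (2 ^ (j + k.+1))%:R)%:E)%E).
  apply: lee_nneseries => [j _ _|j _]; first exact: integral_ge0.
  have -> : 2 / (2 ^ (j + k.+1))%:R = half (k + j) :> R.
    rewrite addnS expnS natrM invfM mulrA divff// mul1r natrX /half exprVn.
    by rewrite addnC.
  apply: l1_le_l2 => //.
    by apply: measurable_funB; exact: measurableT_comp.
  apply: (sqdist_le z (k + j) (N (k + j).+1 z) (N (k + j)%N z) dz).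
  - by have [/ltnW] := NP (k + j).+1 z.
  - by have [] := NP (k + j)%N z.
  (* The index chosen at the next level is near-optimal at this one too; the single new competitor,
     [m = k + j], is handled by monotonicity of the squared norms. *)
  - have [kN NkP] := NP (k + j).+1 z; split => [|m _ /=]; first exact: ltnW.
    have [jm|Nm] := leqP (k + j).+1 m; last first.
      rewrite (le_trans (sq_nondecreasing _ _ _ dz (leq_trans (ltnW Nm) kN)))//.
      by rewrite lerDl exprn_ge0// ltW.
    rewrite (le_trans (NkP _ jm))// lerD2l lerXn2r//.
    + by rewrite nnegrE ltW.
    + by rewrite nnegrE ltW.
    + by rewrite /half exprS ler_piMl ?exprn_ge0 ?invf_le1 ?ler1n ?invr_ge0.
  - exact: NP.
rewrite (cvg_lim _ (@cvg_geometric_eseries_half R 2 k))//.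
by rewrite /half exprVn.
Qed.

(** Once [k] is at least the length of [r], [u k] has integral exactly [nu z (cell r)]. The limsup
    differs from it by at most [tail k], whose integral vanishes as [k] grows. *)
Let integral_limit_density_cell z r : dominated z ->
  (\int[mu z]_(x in cell r) F (z, x) = nu z (cell r))%E.
Proof.
move=> dz.
have mF : measurable_fun (cell r) (fun x => F (z, x)).
  by apply: measurable_funTS; exact: measurableT_comp measurable_limit_density _.
have mu_ k : measurable_fun (cell r) (fun x => (u k (z, x))%:E).
  by apply: measurable_funTS; apply/measurable_EFinP; exact: measurableT_comp.
have mt k : measurable_fun (cell r) (fun x => tail k (z, x)).
  exact: measurable_funTS.
have F0 x : (0 <= F (z, x))%E by exact: limit_density_ge0.
have u0 k x : (0 <= (u k (z, x))%:E)%E by rewrite lee_fin dens_ge0.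
have tail_cell k :
    (\int[mu z]_(x in cell r) tail k (z, x) <= (2 * half k)%:E)%E.
  apply: le_trans (integral_tail k z dz).
  by apply: ge0_subset_integral => //; exact: measurable_funTS.
have u_cell k : (size r <= k)%N ->
    (\int[mu z]_(x in cell r) (u k (z, x))%:E = nu z (cell r))%E.
  move=> rk; rewrite /u /= integral_dens// (leq_trans rk)//.
  by have [] := NP k z.
have small (e : R) : 0 < e -> exists2 k, (size r <= k)%N & 2 * half k <= e.
  move=> e0; have [|k ke] := exists_invr_lt (e / 2); first exact: divr_gt0.
  exists (maxn k (size r)); first exact: leq_maxr.
  rewrite mulrC -ler_pdivlMr// (le_trans _ (ltW ke))// /half exprVn.
  rewrite lef_pV2 ?posrE ?exprn_gt0// -natrX ler_nat.
  rewrite (leq_trans _ (ltn_expl _ _))// ltnS leq_maxl.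
by [].
apply/eqP; rewrite eq_le; apply/andP; split; apply/lee_addgt0Pr => e e0.
  have [k rk ke] := small e e0.
  apply: (@le_trans _ _ (\int[mu z]_(x in cell r) (u k (z, x))%:E
      + \int[mu z]_(x in cell r) tail k (z, x))%E); last first.
    by rewrite u_cell// leeD2l// (le_trans (tail_cell k))// lee_fin.
  rewrite -ge0_integralD//; apply: ge0_le_integral => //.
  exact: emeasurable_funD.
have [k rk ke] := small e e0; rewrite -(u_cell k rk).
apply: (@le_trans _ _ (\int[mu z]_(x in cell r) F (z, x)
    + \int[mu z]_(x in cell r) tail k (z, x))%E); last first.
  by rewrite leeD2l// (le_trans (tail_cell k))// lee_fin.
rewrite -ge0_integralD//; apply: ge0_le_integral => //.
exact: emeasurable_funD.
Qed.

Lemma integral_limit_density z B :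
  (forall B, measurable B -> nu z B <= mu z B)%E -> measurable B ->
  (\int[mu z]_(x in B) F (z, x) = nu z B)%E.
Proof.
move=> dz mB.
have mF : measurable_fun setT (fun x => F (z, x)).
  exact: measurableT_comp measurable_limit_density _.
apply: (measure_unique_code b g (density_measure (mu z) (fun x => F (z, x)))
  (nu z)) => //.
- by move=> x; exact: limit_density_ge0.
- have cellT : cell [::] = setT by rewrite /cell cylinder_nil preimage_setT.
  move=> F0; have := integral_limit_density_cell z [::] dz.
  rewrite cellT => nuE; change (\int[mu z]_x F (z, x) < +oo)%E.
  by rewrite nuE -ge0_fin_numE//; exact: nu_fin.
- by move=> F0 r; exact: integral_limit_density_cell.
Qed.

End limit.

(** A Radon-Nikodym derivative depending measurably on the parameter: choosing the least
    near-optimal index at each level makes the subsequence measurable in [z]. *)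
Lemma kernel_density : exists f : Z * X -> \bar R,
  [/\ measurable_fun setT f, forall zx, (0 <= f zx <= 1)%E &
      forall z, (forall B, measurable B -> nu z B <= mu z B)%E ->
      forall B, measurable B -> (\int[mu z]_(x in B) f (z, x) = nu z B)%E].
Proof.
have /choice[N NP] k : exists N : Z -> nat,
    (forall z, near_sup k (N z, z)) /\ forall n, measurable [set z | N z = n].
  apply: (measurable_fun_first (fun n => [set z | near_sup k (n, z)])) => //.
  exact: exists_near_sup.
have N1 k z := (NP k).1 z; have N2 k n := (NP k).2 n.
exists (limit_density N); split.
- exact: measurable_limit_density.
- by move=> zx; rewrite limit_density_ge0// limit_density_le1.
- by move=> z dz B mB; exact: integral_limit_density.
Qed.

End kernel_density.
(** * Randomization *)

(** Splitting [0, F [::]) into consecutive intervals of lengths [F r], level by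
    level, turns a uniform random number into random bits whose prefix is [r]
    with probability [F r]. *)
Section splitting.
Context {R : realType}.
Variable F : seq bool -> R.

(** Left endpoint of the interval of a word: the [false] child fills the left part of its parent,
    the [true] child the right part. *)
Fixpoint lower (r : seq bool) : R :=
  if r is c :: r' then lower r' + (if c then F (false :: r') else 0) else 0.

Fixpoint word (u : R) (n : nat) : seq bool :=
  if n is m.+1 then
    (lower (word u m) + F (false :: word u m) <= u) :: word u m
  else [::].

Definition bits (u : R) : cantor := fun n =>
  lower (word u n) + F (false :: word u n) <= u.

Lemma rprefix_bits u n : rprefix (bits u) n = word u n.
Proof. by elim: n => //= n ->. Qed.

Lemma bits_cylinder r :
  (forall r, F r = F (true :: r) + F (false :: r)) -> (forall r, 0 <= F r) ->
  [set u | 0 <= u < F [::]] `&` bits @^-1` cylinder r =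
    `[lower r, lower r + F r[%classic.
Proof.
move=> Fadd F0; elim: r => [|c r IH].
  rewrite cylinder_nil preimage_setT setIT add0r.
  by apply/seteqP; split => u /=; rewrite in_itv.
rewrite cylinder_cons preimage_setI setIA IH.
have Ft := F0 (true :: r); have Ff := F0 (false :: r); have Fr := Fadd r.
apply/seteqP; split => u; rewrite /= !in_itv /=.
  move=> [/andP[lu uF]].
  (* By induction the first bits of [u] spell [r], so the next bit compares [u] with the split point
     of the interval of [r]. *)
  have : ([set u | 0 <= u < F [::]] `&` bits @^-1` cylinder r) u.
    by rewrite IH /= in_itv /= lu.
  move=> [_]; rewrite /cylinder /= rprefix_bits /bits => ->.
  case: c; [move=> h|move/negbT; rewrite -ltNge => h]; lra.
move=> /andP[lu uF].
have ur : ([set u | 0 <= u < F [::]] `&` bits @^-1` cylinder r) u.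
  by rewrite IH /= in_itv /=; move: lu uF; case: c; lra.
split; first by move: ur; rewrite IH /= in_itv.
move: ur => [_]; rewrite /cylinder /= rprefix_bits /bits => ->.
by move: lu uF; case: c => lu uF; [|apply/negbTE; rewrite -ltNge]; lra.
Qed.

Lemma lebesgue_bits_cylinder r :
  (forall r, F r = F (true :: r) + F (false :: r)) -> (forall r, 0 <= F r) ->
  lebesgue_measure ([set u | 0 <= u < F [::]] `&` bits @^-1` cylinder r) =
    (F r)%:E.
Proof.
move=> Fadd F0; rewrite bits_cylinder// lebesgue_measure_itv /= lte_fin.
case: ltP => [_|]; first by rewrite -EFinB addrC addKr.
by rewrite gerDl => Fr; congr EFin; apply/eqP; rewrite eq_le Fr F0.
Qed.

End splitting.

(** Once the first letters spell [r], the next one compares [u] with a measurable function of [y];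
    hence an induction on the word. *)
Lemma measurable_bits {R : realType} {d} {Y : measurableType d}
  (F : seq bool -> Y -> R) : (forall r, measurable_fun setT (F r)) ->
  measurable_fun setT (fun yu : Y * R => bits (F ^~ yu.1) yu.2).
Proof.
move=> mF; have mlower r : measurable_fun setT (fun y => lower (F ^~ y) r).
  elim: r => //= c r IH; apply: measurable_funD => //.
  by case: c.
apply: measurable_fun_cylinder; elim => [|c r IH].
  by rewrite cylinder_nil preimage_setT.
pose E := [set yu : Y * R |
  (lower (F ^~ yu.1) r + F (false :: r) yu.1 <= yu.2) = c].
rewrite (_ : _ @^-1` _ =
    (fun yu : Y * R => bits (F ^~ yu.1) yu.2) @^-1` cylinder r `&` E).
  apply: measurableI => //.
  have mE : measurable_fun setT (fun yu : Y * R =>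
      lower (F ^~ yu.1) r + F (false :: r) yu.1 <= yu.2).
    apply: measurable_fun_ler => //; apply: measurable_funD.
      exact: (measurableT_comp (mlower r)).
    exact: (measurableT_comp (mF (false :: r))).
  by have := mE measurableT [set c] I; rewrite setTI.
rewrite cylinder_cons preimage_setI; apply/seteqP; split => -[y u] /=;
  by rewrite /cylinder /= rprefix_bits /bits /E /= => -[-> ->].
Qed.

(** * Measures of rectangles with one side fixed *)

Section slice.
Local Open Scope ereal_scope.
Context {R : realType} {d1 d2 : measure_display}.
Context {T1 : measurableType d1} {T2 : measurableType d2}.
Variables (m : {measure set (T1 * T2) -> \bar R}) (A : set T1).
Hypothesis mA : measurable A.

(** The measurability proof is an argument so that the measure structure can be attached to the
    resulting term. *)
Definition mslice of measurable A : set T2 -> \bar R := fun B => m (A `*` B).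

Let mslice0 : mslice mA set0 = 0.
Proof. by rewrite /mslice setX0 measure0. Qed.

Let mslice_ge0 B : 0 <= mslice mA B.
Proof. exact: measure_ge0. Qed.

Let mslice_semi_sigma_additive : semi_sigma_additive (mslice mA).
Proof.
move=> F mF tF mUF; rewrite /mslice setX_bigcupr.
apply: measure_semi_sigma_additive.
- by move=> n; exact: measurableX.
- apply/trivIsetP => i j _ _ ij; rewrite -setXI.
  by move/trivIsetP : tF => -> //; rewrite setX0.
- by rewrite -setX_bigcupr; exact: measurableX.
Qed.

HB.instance Definition _ := isMeasure.Build _ _ _ (mslice mA)
  mslice0 mslice_ge0 mslice_semi_sigma_additive.

End slice.

(** Every jointly measurable [G] yields the kernel [y |-> law of G (y, u)] with
    [u] uniform on [0, 1). *)
Section randomized_kernel.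
Local Open Scope ereal_scope.
Context {R : realType} {dY dT : measure_display}.
Context {Y : measurableType dY} {T : measurableType dT}.
Variable G : Y * R -> T.
Hypothesis mG : measurable_fun setT G.

Definition randomized of measurable_fun setT G : Y -> set T -> \bar R :=
  fun y A => lebesgue_measure [set u : R | A (G (y, u)) /\ (0 <= u < 1)%R].

Let unit_itv : [set u : R | (0 <= u < 1)%R] = `[0%R, 1%R[%classic.
Proof. by apply/seteqP; split => u /=; rewrite in_itv. Qed.

Lemma measurable_uniform_section y A : measurable A ->
  measurable [set u : R | A (G (y, u)) /\ (0 <= u < 1)%R].
Proof.
move=> mA.
rewrite (_ : [set _ | _] = (fun u => G (y, u)) @^-1` A `&` `[0%R, 1%R[%classic).
  apply: measurableI => //; rewrite -[X in measurable X]setTI.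
  exact: (measurable_fun_pair2 y mG).
by rewrite -unit_itv.
Qed.

Let randomized0 y : randomized mG y set0 = 0.
Proof.
rewrite /randomized (_ : [set _ | _] = set0) ?measure0//.
by apply/seteqP; split => // u [].
Qed.

Let randomized_ge0 y A : 0 <= randomized mG y A.
Proof. exact: measure_ge0. Qed.

Let randomized_semi_sigma_additive y : semi_sigma_additive (randomized mG y).
Proof.
move=> F mF tF mUF; rewrite /randomized.
rewrite (_ : [set _ | _] =
    \bigcup_n [set u | F n (G (y, u)) /\ (0 <= u < 1)%R]); last first.
  apply/seteqP; split => [u [[n _ Fn] u01]|u [n _ [Fn u01]]].
    by exists n.
  by split => //; exists n.
apply: measure_semi_sigma_additive.
- by move=> n; exact: measurable_uniform_section.
- apply/trivIsetP => i j _ _ ij; apply/seteqP; split => // u [[Fi _] [Fj _]].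
  have : (F i `&` F j) (G (y, u)) by [].
  by move/trivIsetP : tF => /(_ i j I I ij) ->.
- by apply: bigcupT_measurable => n; exact: measurable_uniform_section.
Qed.

HB.instance Definition _ y := isMeasure.Build _ _ _ (randomized mG y)
  (randomized0 y) (randomized_ge0 y) (@randomized_semi_sigma_additive y).

Definition randomized_kernel : Y -> {measure set T -> \bar R} :=
  randomized mG.

Let measurable_randomized A : measurable A ->
  measurable_fun setT (randomized_kernel ^~ A).
Proof.
move=> mA.
pose E := [set yu : Y * R | A (G yu) /\ (0 <= yu.2 < 1)%R].
have mE : measurable E.
  rewrite (_ : E = G @^-1` A `&` (setT `*` `[0%R, 1%R[%classic)).
    apply: measurableI; last exact: measurableX.
    by rewrite -[X in measurable X]setTI; exact: mG.
  by rewrite -unit_itv; apply/seteqP; split => [[y u] []|[y u] [? []]].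
have := measurable_fun_xsection lebesgue_measure mE.
congr (measurable_fun _ _); apply/funext => y /=; congr lebesgue_measure.
by apply/seteqP; split => u; rewrite /xsection /= ?inE.
Qed.

HB.instance Definition _ :=
  isKernel.Build _ _ _ _ _ randomized_kernel measurable_randomized.

Let randomized_setT y : randomized_kernel y setT = 1.
Proof.
rewrite /randomized_kernel /= /randomized.
rewrite (_ : [set _ | _] = `[0%R, 1%R[%classic).
  by rewrite lebesgue_measure_itv /= lte_fin ltr01 oppr0 adde0.
by rewrite -unit_itv; apply/seteqP; split => [u []|u].
Qed.

HB.instance Definition _ := Kernel_isProbability.Build _ _ _ _ _
  randomized_kernel randomized_setT.

End randomized_kernel.

(** * Simulating a measure from its cell densities *)

Section randomization.
Context {R : realType} {dS dX : measure_display}.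
Context {S : measurableType dS} {X : measurableType dX}.
Variables (b : S -> cantor) (g : cantor -> S).
Hypothesis bg : cantor_code b g.
Variables (m : {measure set X -> \bar R}) (w : {measure set (S * X) -> \bar R}).
Hypothesis w_fin : (w setT < +oo)%E.
Variable f : seq bool -> X -> R.
Hypothesis mf : forall r, measurable_fun setT (f r).
Hypothesis f0 : forall r x, 0 <= f r x.
Hypothesis int_f : forall r B, measurable B ->
  (\int[m]_(x in B) (f r x)%:E = w ((b @^-1` cylinder r) `*` B))%E.

Let mb : measurable_fun setT b. Proof. by case: bg. Qed.

Let mg : measurable_fun setT g. Proof. by case: bg. Qed.

Let bK : cancel b g. Proof. by case: bg. Qed.

Let measurable_cell r : measurable (b @^-1` cylinder r).
Proof.
rewrite -[X in measurable X]setTI; apply: mb => //.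
exact: measurable_cylinder.
Qed.

Let w_lty A : measurable A -> (w A < +oo)%E.
Proof.
by move=> mA; apply: le_lt_trans w_fin; apply: le_measure; rewrite ?inE.
Qed.

(** For a fixed word both sides have the same integral over every measurable set, hence agree almost
    everywhere; words are countable, so one null set serves for all. *)
Lemma cell_density_consistent :
  {ae m, forall x, forall r, f r x = f (true :: r) x + f (false :: r) x}.
Proof.
pose P n (x : X) := if (choice.unpickle n : option (seq bool)) is Some r
  then f r x = f (true :: r) x + f (false :: r) x else True.
suff : {ae m, forall x, forall n, P n x}.
  apply: filterS => x Px r.
  by have := Px (choice.pickle r); rewrite /P choice.pickleK.
apply: ae_foralln => n; rewrite /P.
case: (choice.unpickle n) => [r|]; last exact: aeW.
have mE k : measurable_fun setT (fun x => (f k x)%:E).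
  exact/measurable_EFinP.
have ge0E k x : (0 <= (f k x)%:E)%E by rewrite lee_fin.
have : ae_eq m setT (fun x => (f r x)%:E)
    (fun x => (f (true :: r) x)%:E + (f (false :: r) x)%:E)%E.
  apply: integral_ae_eq => //.
  - apply/integrableP; split => //.
    under eq_integral do rewrite gee0_abs//.
    by rewrite int_f// w_lty//; exact: measurableX.
  - exact: emeasurable_funD.
  move=> B _ mB; rewrite ge0_integralD//; last 2 first.
  - exact: measurable_funTS.
  - exact: measurable_funTS.
  rewrite !int_f// [in LHS]cylinderE preimage_setU.
  rewrite (_ : (_ `|` _) `*` B = (b @^-1` cylinder (true :: r)) `*` B `|`
    (b @^-1` cylinder (false :: r)) `*` B); last first.
    apply/seteqP; split => -[s x] /=.
      by move=> [[bs|bs] Bx]; [left|right].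
    by move=> [[bs Bx]|[bs Bx]]; split => //; [left|right].
  rewrite measureU//; try exact: measurableX.
  apply/seteqP; split => // -[s x] [[/= bt _] [/= bf _]].
  have /eqP := cylinder_disj r; rewrite -subset0; apply; split.
  - exact: bt.
  - exact: bf.
by apply: filterS => x /= /(_ I) [].
Qed.

Let code (xu : X * R) : cantor := bits (f ^~ xu.1) xu.2.

Let measurable_code : measurable_fun setT code.
Proof. exact: measurable_bits. Qed.

(** The region over [B] below the graph of [f [::]], that is, the pairs whose number falls into the
    interval being split. *)
Let live B : set (X * R) := [set xu | B xu.1 /\ 0 <= xu.2 < f [::] xu.1].

Let measurable_live B : measurable B -> measurable (live B).
Proof.
move=> mB.
rewrite (_ : live B = (fst @^-1` B `&` [set xu | 0 <= xu.2]) `&`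
    [set xu : X * R | xu.2 < f [::] xu.1]); last first.
  apply/seteqP; split => -[x u] /=.
    by move=> [Bx /andP[u0 uf]].
  by move=> [[Bx u0] uf]; split => //; rewrite u0.
apply: measurableI; first apply: measurableI.
- by rewrite -[X in measurable X]setTI; exact: measurable_fst.
- have := @measurable_fun_ler _ _ R setT (cst 0) (snd : X * R -> R)
    (measurable_cst _) measurable_snd.
  by move=> /(_ measurableT [set true] I); rewrite setTI.
- have := @measurable_fun_ltr _ _ R setT (snd : X * R -> R)
    (f [::] \o fst) measurable_snd (measurableT_comp (mf [::]) measurable_fst).
  by move=> /(_ measurableT [set true] I); rewrite setTI.
Qed.

(** For almost every [x] in [B], the section is the interval of [r], of length [f r x]; integrating
    over [B] gives the mass under [w]. *)
Let code_law_cylinder B r : measurable B ->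
  ((m \x lebesgue_measure) (code @^-1` cylinder r `&` live B) =
   w ((b @^-1` cylinder r) `*` B))%E.
Proof.
move=> mB; rewrite -int_f// /product_measure1 [RHS]integral_mkcond.
have mS : measurable (code @^-1` cylinder r `&` live B).
  apply: measurableI; last exact: measurable_live.
  rewrite -[X in measurable X]setTI; apply: measurable_code => //.
  exact: measurable_cylinder.
apply: ge0_ae_eq_integral => //.
- exact: measurable_fun_xsection.
- apply/(measurable_restrictT _ mB); apply: measurable_funTS.
  exact/measurable_EFinP.
- by move=> x _; rewrite patchE; case: ifP => // _; rewrite lee_fin.
move: cell_density_consistent; apply: filterS => x fD _ /=.
rewrite patchE; case: ifPn => [/set_mem Bx|/negP Bx].
  rewrite -(lebesgue_bits_cylinder (f ^~ x))//; congr lebesgue_measure.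
  apply/seteqP; split => u; rewrite /xsection /= inE /live /=.
    by move=> [? []].
  by move=> [].
rewrite (_ : xsection _ _ = set0) ?measure0//.
apply/seteqP; split => // u; rewrite /xsection /= inE => -[_ [/= /mem_set]].
by move/Bx.
Qed.

Let code_law B C : measurable B -> measurable C ->
  ((m \x lebesgue_measure) (code @^-1` C `&` live B) =
   w ((b @^-1` C) `*` B))%E.
Proof.
move=> mB mC.
have mTB : measurable (setT `*` B : set (S * X)) by exact: measurableX.
have wE D : w ((b @^-1` D) `*` B) = w (((b \o fst) @^-1` D) `&` (setT `*` B)).
  by congr (w _); apply/seteqP; split => -[s x] /= [] // ? [].
rewrite wE.
apply: (measure_unique_cantor
  (pushforward (mrestr (m \x lebesgue_measure)%E (measurable_live _ mB)) code)
  (pushforward (mrestr w mTB) (b \o fst)) _ _ C mC) => //.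
- exact: (measurableT_comp mb measurable_fst).
- change ((m \x lebesgue_measure) (code @^-1` setT `&` live B) < +oo)%E.
  by rewrite -cylinder_nil code_law_cylinder// w_lty//; exact: measurableX.
- move=> mbfst r.
  change ((m \x lebesgue_measure) (code @^-1` cylinder r `&` live B) =
    w (((b \o fst) @^-1` cylinder r) `&` (setT `*` B)))%E.
  by rewrite code_law_cylinder// wE.
Qed.

(** Decoded bits paired with [x] have law [w] on the region below [f [::]]: both measures agree on
    rectangles, which form a generating family closed under intersection. *)
Lemma randomization A : measurable A ->
  let E := [set xu | 0 <= xu.2 < f [::] xu.1 /\
                     A (g (bits (f ^~ xu.1) xu.2), xu.1)] in
  measurable E /\ w A = (m \x lebesgue_measure)%E E.
Proof.
move=> mA E.
have mlive := measurable_live _ measurableT.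
pose h (xu : X * R) := (g (code xu), xu.1).
have mh : measurable_fun setT h.
  by apply: measurable_fun_pair => //; exact: (measurableT_comp mg).
have -> : E = h @^-1` A `&` live setT.
  by apply/seteqP; split => -[x u] /= []; [|move=> ? []].
split.
  by apply: measurableI => //; rewrite -[X in measurable X]setTI; exact: mh.
pose G := [set A1 `*` A2 | A1 in @measurable _ S & A2 in @measurable _ X].
apply: (measure_unique G (fun=> setT) _ _ _ _ w
  (pushforward (mrestr (m \x lebesgue_measure)%E mlive) h)) => //.
- by rewrite /G measurable_prod_measurableType.
- move=> _ _ [A1 mA1 [A2 mA2 <-]] [B1 mB1 [B2 mB2 <-]].
  by rewrite -setXI; exists (A1 `&` B1); [exact: measurableI|
    exists (A2 `&` B2) => //; exact: measurableI].
- by move=> _; exists setT => //; exists setT => //; rewrite setXTT.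
- by rewrite bigcup_const.
move=> _ [A1 mA1 [B mB <-]].
change (w (A1 `*` B) =
  (m \x lebesgue_measure) (h @^-1` (A1 `*` B) `&` live setT))%E.
have mgA : measurable (g @^-1` A1).
  by rewrite -[X in measurable X]setTI; exact: mg.
(* Because [g] undoes [b], pulling the preimage of [A1] under [g] back along [b] returns [A1]. *)
have := code_law B (g @^-1` A1) mB mgA.
rewrite (_ : b @^-1` _ = A1); last first.
  by apply/seteqP; split => s /=; rewrite bK.
move=> <-; congr (_ _).
by apply/seteqP; split => -[x u] /=; [move=> [? [? ?]]|move=> [[? ?] [_ ?]]].
Qed.

End randomization.

(** * The control refinement *)

Section kernel_reindex.
Context {R : realType} {d1 d2 d3 : measure_display}.
Context {Y : measurableType d1} {Z : measurableType d2} {T : measurableType d3}.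
Variables (k : R.-pker Z ~> T) (phi : Y -> Z).
Hypothesis mphi : measurable_fun setT phi.

Definition kreindex of measurable_fun setT phi : Y -> {measure set T -> \bar R} :=
  fun y => k (phi y).

Let measurable_kreindex A : measurable A ->
  measurable_fun setT (kreindex mphi ^~ A).
Proof.
by move=> mA; exact: (measurableT_comp (measurable_kernel k A mA) mphi).
Qed.

HB.instance Definition _ :=
  isKernel.Build _ _ _ _ _ (kreindex mphi) measurable_kreindex.

Let kreindex_setT y : kreindex mphi y setT = 1%E.
Proof. exact: prob_kernel. Qed.

HB.instance Definition _ := Kernel_isProbability.Build _ _ _ _ _
  (kreindex mphi) kreindex_setT.

End kernel_reindex.

Section kernel_mixture.
Context {R : realType} {d1 d2 d3 : measure_display}.
Context {Z : measurableType d1} {U : measurableType d2} {T : measurableType d3}.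
Variables (l : R.-pker Z ~> U) (k : R.-pker (Z * U)%type ~> T).

Definition kmixture : Z -> {measure set T -> \bar R} := mkcomp l k.

Let measurable_kmixture A : measurable A -> measurable_fun setT (kmixture ^~ A).
Proof. exact: measurable_fun_mkcomp_sfinite. Qed.

HB.instance Definition _ :=
  isKernel.Build _ _ _ _ _ kmixture measurable_kmixture.

Let kmixture_setT z : kmixture z setT = 1%E.
Proof.
rewrite /kmixture /= /kcomp (eq_integral (cst 1%E)) => [|u _].
  by rewrite integral_cst// prob_kernel mule1.
exact: prob_kernel.
Qed.

HB.instance Definition _ := Kernel_isProbability.Build _ _ _ _ _
  kmixture kmixture_setT.

End kernel_mixture.

Lemma measurable_kernel_ysection {R : realType} {d1 d2}
  {X : measurableType d1} {S : measurableType d2} (k : R.-pker X ~> S)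
  (A : set (S * X)) : measurable A ->
  measurable_fun setT (fun x => k x [set s | A (s, x)]).
Proof.
move=> mA.
have mA' : measurable ((fun xs : X * S => (xs.2, xs.1)) @^-1` A).
  rewrite -[X in measurable X]setTI.
  by apply: (measurable_fun_pair measurable_snd measurable_fst).
have := measurable_fun_xsection_finite_kernel k (mem_set mA').
congr (measurable_fun _ _); apply/funext => x /=; congr (k x _).
by apply/seteqP; split => s; rewrite /xsection /= inE.
Qed.

(** The slices of [v z] over the cells of [S] have densities with respect to [p z]; splitting the
    unit interval along them defines [s], and the sections producing [v z] lie inside the events
    that define [s]. *)
Lemma kernel_domination {R : realType} {dZ dS dX : measure_display}
  {Z : measurableType dZ} {S : measurableType dS} {X : measurableType dX}
  (bS : S -> cantor) (gS : cantor -> S) (bX : X -> cantor) (gX : cantor -> X)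
  (p : R.-pker Z ~> X) (v : R.-spker Z ~> (S * X)%type) :
  cantor_code bS gS -> cantor_code bX gX ->
  exists s : R.-pker (Z * X)%type ~> S, forall z,
    (forall B, measurable B -> v z (setT `*` B) <= p z B)%E ->
    forall A, measurable A ->
      (v z A <= \int[p z]_x s (z, x) [set y | A (y, x)])%E.
Proof.
move=> codeS codeX; have [mb mg bK] := codeS.
have mC r : measurable (bS @^-1` cylinder r).
  rewrite -[X in measurable X]setTI; apply: mb => //.
  exact: measurable_cylinder.
have /choice[f fP] r := kernel_density bX gX codeX p
  (fun z => mslice (v z) _ (mC r))
  (fun B mB => measurable_kernel v _ (measurableX (mC r) mB)).
have mf r : measurable_fun setT (f r) by case: (fP r).
have f01 r zx : (0 <= f r zx <= 1)%E by case: (fP r).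
have f_fin r zx : f r zx \is a fin_num.
  have /andP[f0 f1] := f01 r zx.
  by rewrite ge0_fin_numE// (le_lt_trans f1)// ltry.
pose F r zx := fine (f r zx).
have mF r : measurable_fun setT (F r) by exact: measurableT_comp.
have F0 r zx : 0 <= F r zx by rewrite fine_ge0//; case/andP: (f01 r zx).
have F1 r zx : F r zx <= 1.
  by rewrite -lee_fin fineK//; case/andP: (f01 r zx).
(* Numbers at or above [F [::]] belong to no interval and are sent to [point], so that [s] has total
   mass one. *)
pose G (yu : (Z * X) * R) : S :=
  if yu.2 < F [::] yu.1 then gS (bits (F ^~ yu.1) yu.2) else point.
have mG : measurable_fun setT G.
  apply: measurable_fun_ifT => //.
    apply: measurable_fun_ltr => //.
    exact: (measurableT_comp (mF [::])).
  apply: (measurableT_comp mg); exact: measurable_bits.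
exists (randomized_kernel G mG) => z dz A mA.
have [||r x|r B mB|mE ->] := randomization bS gS codeS (p z) (v z) _
    (fun r x => F r (z, x)) _ _ _ A mA.
- by rewrite (le_lt_trans (sprob_kernel_le1 v z))// ltry.
- by move=> r; exact: (measurableT_comp (mF r) (measurable_pair1 z)).
- by [].
- under eq_integral do rewrite fineK//.
  have [_ _ /(_ z)] := fP r; apply => // D mD.
  change (v z ((bS @^-1` cylinder r) `*` D) <= p z D)%E.
  apply: le_trans (dz D mD); apply: le_measure; rewrite ?inE.
  + exact: measurableX.
  + exact: measurableX.
  + by move=> [s x] [].
rewrite /product_measure1.
apply: ge0_le_integral => //.
- exact: measurable_fun_xsection.
- have := measurable_kernel_ysection
    (kreindex (randomized_kernel G mG) (pair z) (measurable_pair1 z)) A mA.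
  by [].
move=> x _; rewrite /= /randomized; apply: le_measure; rewrite ?inE.
- exact: measurable_xsection.
- apply: measurable_uniform_section => //; rewrite -[X in measurable X]setTI.
  exact: (measurable_pair2 x).
(* As [F [::]] is at most 1, a number below it lies in the unit interval, where [G] decodes it. *)
move=> u; rewrite /xsection /= inE /= => -[/andP[u0 uF] Au].
by rewrite /G /= uF; split => //; rewrite u0 (lt_le_trans uF).
Qed.

Theorem theorem2 (R : realType)
  (dXh dUh dX dU dY : measure_display)
  (Xh : measurableType dXh) (Uh : measurableType dUh)
  (X : measurableType dX) (U : measurableType dU) (Y : measurableType dY)
  (hXh : polish_borel R Xh) (hUh : polish_borel R Uh)
  (hX : polish_borel R X) (hU : polish_borel R U)
  (dY_ : Y -> Y -> R) (hdY : is_metric dY_)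
  (xh0 : Xh) (th : R.-pker (Xh * Uh)%type ~> Xh) (hh : Xh -> Y)
  (hhm : measurable_fun setT hh)
  (x0 : X) (t : R.-pker (X * U)%type ~> X) (h : X -> Y)
  (hm : measurable_fun setT h)
  (eps delta : R) (hdelta : 0 <= delta <= 1)
  (Rel : set (Xh * X)%type) (I : R.-pker (Xh * X * Uh)%type ~> U)
  (v : R.-spker (Xh * X * Uh)%type ~> (Xh * X)%type) :
  sub_sim_witness dY_ xh0 th hh x0 t h eps delta Rel I v ->
  exists s : R.-pker (Xh * X * X * Uh)%type ~> Xh,
    valid_refinement t Rel I v s.
Proof.
move=> [_ _ coupling _].
have [bS [gS codeS]] := polish_cantor_code hXh.
have [bX [gX codeX]] := polish_cantor_code hX.
have mxu : measurable_fun setT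
    (fun zu : (Xh * X * Uh) * U => (zu.1.1.2, zu.2)).
  apply: measurable_fun_pair => //.
  exact: (measurableT_comp measurable_snd
    (measurableT_comp measurable_fst measurable_fst)).
(* [p] is the law of the new state under the interface, as a kernel in the triple of parameters. *)
pose t' := kreindex t _ mxu.
pose p := kmixture I t'.
have [s sP] := kernel_domination bS gS bX gX p v codeS codeX.
have mphi : measurable_fun setT (fun y : Xh * X * X * Uh =>
    ((y.1.1.1, y.1.1.2, y.2), y.1.2)).
  have m1 : measurable_fun setT (fun y : Xh * X * X * Uh => y.1).
    exact: measurable_fst.
  have m11 := measurableT_comp measurable_fst m1.
  apply: measurable_fun_pair; last exact: (measurableT_comp measurable_snd m1).
  apply: measurable_fun_pair; last exact: measurable_snd.
  apply: measurable_fun_pair.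
  - exact: (measurableT_comp measurable_fst m11).
  - exact: (measurableT_comp measurable_snd m11).
exists (kreindex s _ mphi) => xh x uh xRel A mA.
(* The bound on the second marginal is the domination of [v] by [p] at this parameter. *)
have [_ _ _ _ vp] := coupling xh x uh xRel.
apply: le_trans (sP (xh, x, uh) vp A mA) _.
(* The integral against the mixture becomes the iterated integral in [tcomposed]. *)
rewrite /p /kmixture /= integral_kcomp//.
exact: (measurable_kernel_ysection
  (kreindex s _ (measurable_pair1 (xh, x, uh))) A mA).
Qed.
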